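(* Let $f:\mathbb{R}^d\to\mathbb{R}^L$ be an $L$-class classifier with estimated label $\hat{k}(\boldsymbol{x})=\operatorname{argmax}_k f_k(\boldsymbol{x})$, and let $\mu$ be a probability distribution on $\mathbb{R}^d$. For $\boldsymbol{x}\in\mathbb{R}^d$ let $\boldsymbol{r}(\boldsymbol{x})$ be a minimal perturbation changing the label, i.e. a solution of $\min_{\boldsymbol{r}\in\mathbb{R}^d}\|\boldsymbol{r}\|_2$ subject to $\hat{k}(\boldsymbol{x}+\boldsymbol{r})\neq\hat{k}(\boldsymbol{x})$, and assume $\|\boldsymbol{r}(\boldsymbol{x})\|_2=1$ for all $\boldsymbol{x}\sim\mu$. Let $\xi\ge 0$, $\delta\ge 0$. Let $\mathcal{S}$ be an $m$-dimensional subspace of $\mathbb{R}^d$ such that $\|P_{\mathcal{S}}\boldsymbol{r}(\boldsymbol{x})\|_2\ge 1-\xi$ for $\mu$-almost all $\boldsymbol{x}$, where $P_{\mathcal{S}}$ is the orthogonal projection onto $\mathcal{S}$. Assume moreover that the condition $\mathscr{L}_s(\boldsymbol{x},\rho)$ holds for $\mu$-almost all $\boldsymbol{x}$, with $\rho=\frac{\sqrt{e m}}{\delta(1-\xi)}$, where $\mathscr{L}_s(\boldsymbol{x},\rho)$ is the statement: for all $\boldsymbol{v}\in\mathbb{R}^d$ with $\|\boldsymbol{v}\|_2\le\rho$, if $|\boldsymbol{r}(\boldsymbol{x})^T\boldsymbol{v}|\ge\|\boldsymbol{r}(\boldsymbol{x})\|_2^2$ then $\hat{k}(\boldsymbol{x}+\boldsymbol{v})\neq\hat{k}(\boldsymbol{x})$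 or $\hat{k}(\boldsymbol{x}-\boldsymbol{v})\neq\hat{k}(\boldsymbol{x})$. Then there exists a vector $\boldsymbol{v}\in\mathbb{R}^d$ with $\|\boldsymbol{v}\|_2\le\rho$ such that $$\mathbb{P}_{\boldsymbol{x}\sim\mu}\big(\hat{k}(\boldsymbol{x}+\boldsymbol{v})\neq\hat{k}(\boldsymbol{x})\ \text{or}\ \hat{k}(\boldsymbol{x}-\boldsymbol{v})\neq\hat{k}(\boldsymbol{x})\big)\ge 1-\delta.$$
   Context: $f_k$ denotes the $k$-th component of $f$. The ball $B(\rho)$ is the closed Euclidean ball of radius $\rho$ centered at $\mathbf{0}$. The quantity $\boldsymbol{r}(\boldsymbol{x})$ is the minimal-norm (adversarial) perturbation of $\boldsymbol{x}$; $\boldsymbol{x}+\boldsymbol{r}(\boldsymbol{x})$ lies on the decision boundary.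
   Formalization: The formal theorem assumes δ > 0 and ξ < 1, since ρ is undefined when δ = 0 or ξ = 1 and is negative (so no v exists) when ξ > 1 and m ≥ 1; it also assumes the label function is Borel measurable so that the probability is defined. *)

(* Defs.v *)
From HB Require Import structures.
From mathcomp Require Import all_boot all_order all_algebra.
From mathcomp Require Import all_classical all_reals all_analysis.
Set Implicit Arguments. Unset Strict Implicit. Unset Printing Implicit Defensive.
Import Order.TTheory GRing.Theory Num.Theory numFieldNormedType.Exports.
Local Open Scope ring_scope.
Local Open Scope classical_set_scope.

(* R^d is modelled by row vectors 'rV[R]_d.  [Rd R d] is the same carrier
   equipped with the Borel sigma-algebra (generated by the open sets of the
   standard topology of 'rV[R]_d). *)
Definition Rd (R : realType) (d : nat) := g_sigma_algebraType (@open 'rV[R]_d).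

Definition dotv (R : realType) (d : nat) (u v : 'rV[R]_d) : R :=
  \sum_(i < d) u 0 i * v 0 i.
Definition norm2 (R : realType) (d : nat) (v : 'rV[R]_d) : R :=
  Num.sqrt (dotv v v).

(* Orthogonal projection onto the subspace (row space) of S: the projection
   onto <<S>> along its orthogonal complement kermx S^T
   = {u | u *m S^T = 0} = {u | u is orthogonal to every row of S}. *)
Definition orth_proj (R : realType) (d : nat) (S : 'M[R]_d) (v : 'rV[R]_d)
  : 'rV[R]_d := v *m proj_mx <<S>>%MS (kermx S^T).

Definition is_argmax (R : realType) (d L : nat) (f : 'rV[R]_d -> 'rV[R]_L)
  (khat : 'rV[R]_d -> 'I_L) : Prop :=
  forall x k, f x 0 k <= f x 0 (khat x).

Definition is_min_pert (R : realType) (d L : nat) (khat : 'rV[R]_d -> 'I_L)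
  (x r : 'rV[R]_d) : Prop :=
  khat (x + r) <> khat x /\
  forall r', khat (x + r') <> khat x -> norm2 r <= norm2 r'.

Definition Ls (R : realType) (d L : nat) (khat : 'rV[R]_d -> 'I_L)
  (r : 'rV[R]_d -> 'rV[R]_d) (x : 'rV[R]_d) (rho : R) : Prop :=
  forall v : 'rV[R]_d, norm2 v <= rho ->
    norm2 (r x) ^+ 2 <= `|dotv (r x) v| ->
    khat (x + v) <> khat x \/ khat (x - v) <> khat x.

(* Main.v *)
(* The vector v is drawn from the sphere of radius rho in S, as v = rho G / |G| with G
   standard Gaussian on S.  If both x + v and x - v keep the label of x, then the
   condition Ls forces |<r(x), v>| < 1, i.e. b (w.G)^2 <= p |G|^2 for the normalised
   projection w of r(x) on S (|w| >= 1) and suitable p, b > 0.  By the exponential Markov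
   inequality this has probability at most
   E exp ((p |G|^2 - b (w.G)^2) / 2), a Gaussian integral computed one coordinate at a
   time by completing squares; choosing p = 1 / (m + 1) makes it smaller than delta.
   Tonelli then gives one v that works for a set of x of measure at least 1 - delta.
   It is applied to the indicator of the pairs (x, G) whose label is preserved, which is
   measurable although r might not be. *)
Require Import Defs.
From HB Require Import structures.
From mathcomp Require Import all_boot all_order all_algebra.
From mathcomp Require Import all_classical all_reals all_analysis.
From mathcomp Require Import measurable_realfun ring.
Import Order.TTheory GRing.Theory Num.Theory numFieldNormedType.Exports.
Local Open Scope ring_scope.
Local Open Scope classical_set_scope.

(** * Orthonormal bases and orthogonal projections *)

Section DotProduct.
Context {R : realType} {d : nat}.
Implicit Types u v : 'rV[R]_d.

Lemma dotvE u v : u *m v^T = (dotv u v)%:M.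
Proof.
by rewrite [LHS]mx11_scalar mxE; congr _%:M; apply: eq_bigr => i _; rewrite mxE.
Qed.

Lemma dotvv_ge0 v : 0 <= dotv v v.
Proof. by apply: sumr_ge0 => i _; exact: sqr_ge0. Qed.

Lemma dotvv_eq0 v : (dotv v v == 0) = (v == 0).
Proof.
apply/idP/eqP => [|->]; last by rewrite /dotv big1// => i _; rewrite mxE mul0r.
rewrite psumr_eq0; last by move=> i _; exact: sqr_ge0.
move=> /allP v0; apply/rowP => i; rewrite mxE; apply/eqP.
by have := v0 i (mem_index_enum i); rewrite -expr2 sqrf_eq0.
Qed.

Lemma norm2_ge0 v : 0 <= norm2 v. Proof. exact: sqrtr_ge0. Qed.

Lemma sqr_norm2 v : norm2 v ^+ 2 = dotv v v.
Proof. by rewrite sqr_sqrtr// dotvv_ge0. Qed.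

Lemma norm2_eq0 v : (norm2 v == 0) = (v == 0).
Proof. by rewrite -dotvv_eq0 -sqr_norm2 sqrf_eq0. Qed.

Lemma dotvZr (a : R) u v : dotv u (a *: v) = a * dotv u v.
Proof. by rewrite mulr_sumr; apply: eq_bigr => i _; rewrite mxE mulrCA. Qed.

Lemma dotvZl (a : R) u v : dotv (a *: u) v = a * dotv u v.
Proof. by rewrite mulr_sumr; apply: eq_bigr => i _; rewrite mxE mulrA. Qed.

Lemma norm2Z (a : R) v : norm2 (a *: v) = `|a| * norm2 v.
Proof. by rewrite /norm2 dotvZl dotvZr mulrA -expr2 sqrtrM ?sqr_ge0// sqrtr_sqr. Qed.

End DotProduct.

Section OrthogonalProjection.
Context {R : realType} {d : nat}.
Implicit Types v : 'rV[R]_d.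

(** Induction on the rank: normalise a nonzero vector of [S] to get [e], and recurse on the vectors
    of [S] orthogonal to [e]. Since [e] is not orthogonal to itself, [S *m e^T] has rank 1, and
    rank-nullity leaves rank [n] for that intersection. *)
Lemma orthonormal_basis n (S : 'M[R]_d) : \rank S = n ->
  exists B : 'M[R]_(n, d), (B *m B^T = 1%:M) /\ (B :=: S)%MS.
Proof.
elim: n S => [|n IH] S rS.
  exists 0; split; first by apply/matrixP => -[].
  apply/eqmxP; rewrite sub0mx /=.
  by move/eqP: rS; rewrite mxrank_eq0 => /eqP ->; exact: sub0mx.
have /rowV0Pn[v vS v0] : S != 0 by rewrite -mxrank_eq0 rS.
pose e := (norm2 v)^-1 *: v.
have ee : e *m e^T = 1%:M.
  by rewrite dotvE dotvZl dotvZr -sqr_norm2 expr2 mulKf ?norm2_eq0// mulVf ?norm2_eq0.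
have eS : (e <= S)%MS by exact: scalemx_sub.
have re : \rank (S *m e^T) = 1%N.
  apply/eqP; rewrite eqn_leq rank_leq_col lt0n mxrank_eq0.
  apply/eqP => Se; have /submxP[D De] := eS.
  move: ee; rewrite De -mulmxA -De Se mulmx0 => /matrixP/(_ 0 0).
  by rewrite !mxE eqxx => /eqP; rewrite eq_sym oner_eq0.
pose S' := (S :&: kermx e^T)%MS.
have rS' : \rank S' = n.
  by have := mxrank_mul_ker S e^T; rewrite rS re add1n => -[].
have [B [BB BS']] := IH S' rS'.
have Be : B *m e^T = 0.
  by apply/sub_kermxP; rewrite BS' capmxSr.
pose C : 'M[R]_(1 + n, d) := col_mx e B.
have CC : C *m C^T = 1%:M.
  rewrite tr_col_mx mul_col_row ee Be BB -[e *m B^T]trmxK trmx_mul trmxK Be trmx0.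
  by rewrite -scalar_mx_block.
exists C; split => //; apply/eqmxP.
have CS : (C <= S)%MS by rewrite col_mx_sub eS BS' capmxSl.
rewrite -(geq_leqif (mxrank_leqif_eq CS)) rS.
suff /eqP -> : row_free C by [].
by apply/row_freeP; exists C^T.
Qed.

Lemma norm2_mul_orthonormal n (B : 'M[R]_(n, d)) (c : 'rV[R]_n) :
  B *m B^T = 1%:M -> norm2 (c *m B) = norm2 c.
Proof.
move=> BB; rewrite /norm2; congr Num.sqrt.
have := dotvE (c *m B) (c *m B); rewrite trmx_mul mulmxA -(mulmxA c) BB mulmx1 dotvE.
by move=> /matrixP/(_ 0 0); rewrite !mxE eqxx.
Qed.

(** The residual [v - y] is orthogonal to [S], so [v] and its projection have the same coordinates
    in the orthonormal basis [B]. Norms of projections thus become norms of coordinate rows, which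
    pair with a Gaussian row. *)
Lemma norm2_orth_proj n (S : 'M[R]_d) (B : 'M[R]_(n, d)) v :
  B *m B^T = 1%:M -> (B :=: S)%MS -> norm2 (orth_proj S v) = norm2 (v *m B^T).
Proof.
move=> BB BS; set y := orth_proj S v.
have cap0 : (<<S>> :&: kermx S^T)%MS = 0.
  apply/eqP/rowV0P => z; rewrite sub_capmx genmxE => /andP[/submxP[D zD] /sub_kermxP zS].
  apply/eqP; rewrite -dotvv_eq0; apply/eqP.
  have : z *m z^T = 0 by rewrite {2}zD trmx_mul mulmxA zS mul0mx.
  by rewrite dotvE => /matrixP/(_ 0 0); rewrite !mxE eqxx.
have full : (v <= <<S>> + kermx S^T)%MS.
  apply: submx_full; rewrite /row_full eqn_leq rank_leq_col /=.
  have := mxrank_sum_cap <<S>>%MS (kermx S^T); rewrite cap0 mxrank0 addn0 => ->.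
  by rewrite mxrank_gen mxrank_ker mxrank_tr subnKC// rank_leq_row.
have /submxP[c yc] : (y <= B)%MS.
  by rewrite BS -(genmxE S) proj_mx_sub.
have vy : (v - y) *m B^T = 0.
  have /sub_kermxP vyS : (v - y <= kermx S^T)%MS by exact: proj_mx_compl_sub.
  have /submxP[D ->] : (B <= S)%MS by rewrite BS.
  by rewrite trmx_mul mulmxA vyS mul0mx.
have -> : v *m B^T = c.
  by rewrite -[v](subrK y) mulmxDl vy add0r yc -mulmxA BB mulmx1.
by rewrite yc norm2_mul_orthonormal.
Qed.

End OrthogonalProjection.

(** * Gaussian expectations *)

Section GaussianIntegral.
Context {R : realType}.
Local Open Scope ereal_scope.
Local Notation leb := (@lebesgue_measure R).

(* The expectation under n independent standard normal variables, as an iterated integral. *)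
Fixpoint gint (n : nat) : (n.-tuple R -> \bar R) -> \bar R :=
  match n with
  | 0%N => fun F => F [tuple]
  | n.+1 => fun F =>
      \int[leb]_x ((normal_pdf 0 1 x)%:E * gint n (fun g => F [tuple of x :: g]))
  end.

Lemma gint_ge0 n (F : n.-tuple R -> \bar R) :
  (forall g, 0 <= F g) -> 0 <= gint n F.
Proof.
elim: n F => [|n IH] F F0 /=; first exact: F0.
apply: integral_ge0 => x _; rewrite mule_ge0 ?lee_fin ?normal_pdf_ge0//.
exact: IH.
Qed.

Lemma eq_gint n (F G : n.-tuple R -> \bar R) : F =1 G -> gint n F = gint n G.
Proof. by move=> /funext ->. Qed.

Let mpdf : measurable_fun [set: R] (EFin \o normal_pdf 0 1).
Proof. by apply/measurable_EFinP; exact: measurable_normal_pdf. Qed.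

Let measurable_cons_param d (T : measurableType d) n (F : T * n.+1.-tuple R -> \bar R) :
  measurable_fun setT F ->
  measurable_fun setT
    (fun z : (T * R) * n.-tuple R => F (z.1.1, [tuple of z.1.2 :: z.2])).
Proof.
move=> mF; apply: (measurableT_comp mF); apply/measurable_fun_pairP; split => /=.
  exact: (measurableT_comp measurable_fst measurable_fst).
by apply: measurable_cons => //; exact: (measurableT_comp measurable_snd measurable_fst).
Qed.

(** The parameter space is arbitrary because the induction absorbs the first Gaussian coordinate
    into it; Tonelli's theorem gives measurability once that coordinate is integrated out. *)
Lemma measurable_gint d (T : measurableType d) n (F : T * n.-tuple R -> \bar R) :
  measurable_fun setT F -> (forall z, 0 <= F z) ->
  measurable_fun setT (fun t => gint n (fun g => F (t, g))).
Proof.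
elim: n d T F => [|n IH] d T F mF F0 /=.
  exact: (measurableT_comp mF).
apply: (measurable_fun_fubini_tonelli_F (m2 := leb)
  (fun z : T * R => (normal_pdf 0 1 z.2)%:E *
     gint n (fun g => F (z.1, [tuple of z.2 :: g])))).
- apply: emeasurable_funM; first exact: (measurableT_comp mpdf measurable_snd).
  by apply: (IH _ _ (fun z => F (z.1.1, [tuple of z.1.2 :: z.2]))) => //;
    exact: measurable_cons_param.
- by move=> z; rewrite mule_ge0 ?lee_fin ?normal_pdf_ge0// gint_ge0.
Qed.

Let measurable_gint_cons n (F : n.+1.-tuple R -> \bar R) :
  measurable_fun setT F -> (forall g, 0 <= F g) ->
  measurable_fun setT (fun x => gint n (fun g => F [tuple of x :: g])).
Proof.
move=> mF F0.
apply: (@measurable_gint _ _ _ (fun z : R * n.-tuple R => F [tuple of z.1 :: z.2])) => //.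
by apply: (measurableT_comp mF); exact: measurable_cons.
Qed.

Lemma le_gint n (F G : n.-tuple R -> \bar R) :
  measurable_fun setT F -> measurable_fun setT G ->
  (forall g, 0 <= F g) -> (forall g, F g <= G g) -> gint n F <= gint n G.
Proof.
elim: n F G => [|n IH] F G mF mG F0 FG /=; first exact: FG.
have G0 g : 0 <= G g by exact: le_trans (FG g).
apply: ge0_le_integral => //.
- by move=> x _; rewrite mule_ge0 ?lee_fin ?normal_pdf_ge0// gint_ge0.
- by apply: emeasurable_funM => //; exact: measurable_gint_cons.
- by apply: emeasurable_funM => //; exact: measurable_gint_cons.
- move=> x _; apply: lee_wpmul2l; rewrite ?lee_fin ?normal_pdf_ge0//.
  by apply: IH => //; [apply: (measurableT_comp mF)|apply: (measurableT_comp mG)];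
    exact: measurable_cons.
Qed.

Lemma gint_cst n (c : R) : gint n (fun=> c%:E) = c%:E.
Proof.
elim: n => [//|n IH] /=.
under eq_integral do rewrite IH.
rewrite integralZr//; last exact: integrable_normal_pdf.
by rewrite integral_normal_pdf mul1e.
Qed.

(** One Lebesgue integral at a time is moved past [mu]; the density does not depend on [t] and
    factors out. *)
Lemma gint_tonelli d (T : measurableType d) (mu : {sigma_finite_measure set T -> \bar R})
    n (F : T * n.-tuple R -> \bar R) :
  measurable_fun setT F -> (forall z, 0 <= F z) ->
  \int[mu]_t gint n (fun g => F (t, g)) = gint n (fun g => \int[mu]_t F (t, g)).
Proof.
elim: n F => [//|n IH] F mF F0 /=.
pose H (z : T * R) := (normal_pdf 0 1 z.2)%:E *
     gint n (fun g => F (z.1, [tuple of z.2 :: g])).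
have mg : measurable_fun setT
    (fun z : T * R => gint n (fun g => F (z.1, [tuple of z.2 :: g]))).
  by apply: (@measurable_gint _ _ _ (fun z : (T * R) * _ => F (z.1.1, [tuple of z.1.2 :: z.2])))
    => //; exact: measurable_cons_param.
transitivity (\int[leb]_x \int[mu]_t H (t, x)).
  apply: (fubini_tonelli (m1 := mu) (m2 := leb) H).
  - by apply: emeasurable_funM => //; exact: (measurableT_comp mpdf measurable_snd).
  - by move=> z; rewrite /H mule_ge0 ?lee_fin ?normal_pdf_ge0// gint_ge0.
apply: eq_integral => x _; rewrite /H /=.
rewrite ge0_integralZl//; last 3 first.
- exact: (measurable_fun_pair1 x mg).
- by move=> t _; rewrite gint_ge0.
- by rewrite lee_fin normal_pdf_ge0.
congr (_ * _).
apply: (IH (fun z => F (z.1, [tuple of x :: z.2]))) => //.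
apply: (measurableT_comp mF); apply/measurable_fun_pairP; split => /=.
  exact: measurable_fst.
exact: (measurable_cons (measurable_cst x) measurable_snd).
Qed.

(** If [F] exceeded [c] everywhere, its expectation would be at least [c]. The gap [c' < c] absorbs
    the weak inequality that monotonicity yields. *)
Lemma gint_exists_le n (F : n.-tuple R -> \bar R) (c c' : R) :
  measurable_fun setT F -> (forall g, 0 <= F g) -> (0 <= c)%R -> (c' < c)%R ->
  gint n F <= c'%:E -> exists g, F g <= c%:E.
Proof.
move=> mF F0 c0 cc' Fc; apply: contrapT => /forallNP nF.
have : c%:E <= gint n F.
  rewrite -(gint_cst n c); apply: le_gint => // g.
  by rewrite ltW// ltNge; apply/negP; exact: nF.
by move=> /le_trans /(_ Fc); rewrite lee_fin leNgt cc'.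
Qed.

End GaussianIntegral.

(** * Gaussian integrals of exponentials of quadratic forms *)

Section GaussianMoments.
Context {R : realType}.
Local Notation leb := (@lebesgue_measure R).

(* Completing the square turns the integrand into a multiple of another normal density. *)
Lemma integral_normal_expR_quad (p b c u : R) : p < 1 -> 0 <= b ->
  (\int[leb]_x ((normal_pdf 0 1 x)%:E
      * (expR (p / 2 * x ^+ 2 - b / 2 * (c + u * x) ^+ 2))%:E))%E =
  (Num.sqrt (1 - p + b * u ^+ 2)^-1
    * expR (- (c ^+ 2 / 2 * (b * (1 - p) / (1 - p + b * u ^+ 2)))))%:E.
Proof.
move=> p1 b0; set D := 1 - p + b * u ^+ 2.
have D0 : 0 < D by apply: ltr_pwDl; rewrite ?subr_gt0// mulr_ge0// sqr_ge0.
pose s := Num.sqrt D^-1.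
have s0 : 0 < s by rewrite sqrtr_gt0 invr_gt0.
have s2 : s ^+ 2 = D^-1 by rewrite sqr_sqrtr// invr_ge0 ltW.
set K := s * _.
(* The total exponent is [- D / 2 * (x + b * c * u / D) ^+ 2] plus a constant, which dictates the
   mean and the variance [s ^+ 2 = D^-1]. *)
transitivity (\int[leb]_x (K%:E * (normal_pdf (- (b * c * u / D)) s x)%:E))%E.
  apply: eq_integral => x _; rewrite -!EFinM; congr EFin.
  rewrite !normal_pdfE ?oner_eq0 ?gt_eqF// /normal_peak /normal_fun /K.
  rewrite s2 expr1n mul1r -mulrnAr sqrtrM ?invr_ge0 ?(ltW D0)// -/s invfM.
  rewrite -[LHS]mulrA -expRD; set P := _^-1.
  set X := expR _; set Y := expR _; set Z := expR _.
  have -> : s * Y * (s^-1 * P * Z) = P * (Y * Z) by field; rewrite gt_eqF.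
  rewrite /X /Y /Z -expRD.
  congr (_ * expR _); rewrite /D; field.
  by rewrite -/D gt_eqF.
rewrite integralZl//; last exact: integrable_normal_pdf.
by rewrite integral_normal_pdf mule1.
Qed.

(** Induction on the coordinates: the shift [c] and the constant [e] are there to absorb the first
    coordinate while the others are integrated out. The factor in front of the final [expR] is
    [det ((1 - p) I + b w w^T) ^ (- 1/2)]. *)
Lemma gint_expR_quad n (w : 'I_n -> R) (p b c e : R) : p < 1 -> 0 <= b ->
  gint n (fun g => (expR (e + p / 2 * (\sum_i tnth g i ^+ 2)
                     - b / 2 * (c + \sum_i w i * tnth g i) ^+ 2))%:E) =
  ((Num.sqrt (1 - p))^-1 ^+ n
   * Num.sqrt ((1 - p) / (1 - p + b * \sum_i w i ^+ 2))
   * expR (e - c ^+ 2 / 2 * (b * (1 - p) / (1 - p + b * \sum_i w i ^+ 2))))%:E.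
Proof.
move=> p1 b0; have a0 : 0 < 1 - p by rewrite subr_gt0.
elim: n w c e => [|n IH] w c e.
  rewrite /= !big_ord0 !mulr0 !addr0 mulfV ?gt_eqF// sqrtr1 !mul1r mulfK ?gt_eqF//.
  by congr (expR _)%:E; field.
set W := \sum_(i < n) w (lift ord0 i) ^+ 2.
have W0 : 0 <= W by apply: sumr_ge0 => i _; exact: sqr_ge0.
have D0 : 0 < 1 - p + b * W by apply: ltr_pwDl => //; rewrite mulr_ge0.
have E0 : 0 < 1 - p + b * (w ord0 ^+ 2 + W).
  by apply: ltr_pwDl => //; rewrite mulr_ge0// addr_ge0// sqr_ge0.
rewrite [gint _ _]/=.
set b' := b * (1 - p) / (1 - p + b * W).
have b'0 : 0 <= b' by rewrite /b' divr_ge0// ?mulr_ge0// ltW.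
set K := (Num.sqrt (1 - p))^-1 ^+ n * Num.sqrt ((1 - p) / (1 - p + b * W)).
(* What remains is the one-dimensional integral above, with [b'] in place of [b]. *)
transitivity (\int[leb]_x ((K * expR e)%:E * ((normal_pdf 0 1 x)%:E
  * (expR (p / 2 * x ^+ 2 - b' / 2 * (c + w ord0 * x) ^+ 2))%:E)))%E.
  apply: eq_integral => x _.
  rewrite (eq_gint _ _ (fun g => (expR ((e + p / 2 * x ^+ 2) +
      p / 2 * (\sum_i tnth g i ^+ 2) - b / 2 * ((c + w ord0 * x) +
        \sum_i w (lift ord0 i) * tnth g i) ^+ 2))%:E)); last first.
    move=> g; rewrite !big_ord_recl; congr (expR _)%:E.
    rewrite !tnth0; under eq_bigr do rewrite tnthS.
    under [in X in _ - X]eq_bigr do rewrite tnthS.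
    by rewrite mulrDr !addrA.
  rewrite (IH (fun i => w (lift ord0 i))) -/W -/b' -/K -!EFinM; congr EFin.
  rewrite [RHS]mulrCA; congr (_ * _).
  by rewrite -[RHS]mulrA -expRD; congr (_ * expR _); ring.
rewrite ge0_integralZl//; first last.
- by rewrite lee_fin !mulr_ge0 ?exprn_ge0 ?invr_ge0 ?sqrtr_ge0 ?expR_ge0.
- by move=> x _; rewrite -EFinM lee_fin mulr_ge0 ?normal_pdf_ge0 ?expR_ge0.
- apply/measurable_EFinP; apply: measurable_funM; first exact: measurable_normal_pdf.
  apply: measurableT_comp => //; apply: measurable_funB.
    by apply: measurable_funM => //; exact: measurable_funX.
  apply: measurable_funM => //; apply: measurable_funX.
  by apply: measurable_funD => //; exact: measurable_funM.
rewrite integral_normal_expR_quad// -EFinM; congr EFin.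
rewrite big_ord_recl -/W /K /b'.
have -> : 1 - p + b * (1 - p) / (1 - p + b * W) * w ord0 ^+ 2 =
   (1 - p) * (1 - p + b * (w ord0 ^+ 2 + W)) / (1 - p + b * W).
  by field; rewrite gt_eqF.
have -> : ((1 - p) * (1 - p + b * (w ord0 ^+ 2 + W)) / (1 - p + b * W))^-1 =
   (1 - p + b * W) / ((1 - p) * (1 - p + b * (w ord0 ^+ 2 + W))).
  by rewrite invf_div.
(* The old and new square roots telescope and leave one more factor [(1 - p) ^ (- 1/2)]. *)
have sE : Num.sqrt ((1 - p) / (1 - p + b * W)) *
  Num.sqrt ((1 - p + b * W) / ((1 - p) * (1 - p + b * (w ord0 ^+ 2 + W)))) =
  (Num.sqrt (1 - p))^-1 * Num.sqrt ((1 - p) / (1 - p + b * (w ord0 ^+ 2 + W))).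
  rewrite -sqrtrV ?ltW// -!sqrtrM ?divr_ge0 ?invr_ge0 ?ltW//.
  by congr Num.sqrt; field; rewrite !gt_eqF.
set Y := (X in _ * (_ * expR X) = _).
rewrite [X in _ = _ * expR X](_ : _ = e + Y); last first.
  by rewrite /Y; field; rewrite !gt_eqF.
rewrite expRD mulrACA -!mulrA [in LHS](mulrA (Num.sqrt _) (Num.sqrt _)) sE.
by rewrite [_ ^+ n.+1]exprSr -!mulrA.
Qed.

End GaussianMoments.

(** * The Chernoff bound and its constants *)

(** Raise [1 + x <= expR x] at [x = 1 / (m + 1)] to the power [m + 1]. The quotient is the form in
    which [(1 - p)^-1] appears below. *)
Lemma expR1_bound (R : realType) (m : nat) : ((m.+2%:R / m.+1%:R) ^+ m.+1 : R) <= expR 1.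
Proof.
have -> : expR 1 = expR (m.+1%:R^-1) ^+ m.+1 :> R.
  by rewrite -expRM_natl mulfV.
apply: lerXn2r; [by rewrite nnegrE divr_ge0|by rewrite nnegrE expR_ge0|].
have -> : m.+2%:R / m.+1%:R = 1 + m.+1%:R^-1 :> R.
  by rewrite -[m.+2]add1n natrD mulrDl mulfV// mul1r addrC.
exact: expR_ge1Dx.
Qed.

(* The choice [p = 1 / (n + 1)] makes [(1 - p) ^ (- n) = (1 + 1 / n) ^ n <= e]; this is
   where the constant [e] of the radius comes from. *)
Lemma gaussian_chernoff (R : realType) (n : nat) (delta : R) : (0 < n)%N -> 0 < delta ->
  exists p b c' : R, [/\ [/\ 0 < p, 0 <= b, 0 <= c' & c' < delta],
    b * delta ^+ 2 = p * (expR 1 * n%:R) &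
    forall w : 'I_n -> R, 1 <= \sum_i w i ^+ 2 ->
      (gint n (fun g => (expR (p / 2 * (\sum_i tnth g i ^+ 2)
                     - b / 2 * (\sum_i w i * tnth g i) ^+ 2))%:E) <= c'%:E)%E].
Proof.
case: n => // n _ d0.
(* After the case split the dimension is [n.+1], so [p] is [1 / (n + 2)]. *)
pose a : R := n.+1%:R / n.+2%:R; pose p : R := 1 - a.
have a0 : 0 < a by rewrite divr_gt0.
have pE : p = n.+2%:R^-1.
  rewrite /p /a -[X in X - _](@mulfV _ n.+2%:R)// -mulrBl.
  by rewrite -natrB// subSn// subnn mul1r.
have p0 : 0 < p by rewrite pE invr_gt0.
have ap : 1 - p = a by rewrite /p subKr.
(* Forced by the required relation between [b] and [p], as [p * n.+1%:R = a]. *)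
pose b := a * expR 1 / delta ^+ 2.
have e0 : 0 < expR 1 :> R := expR_gt0 _.
have b0 : 0 < b by rewrite !(divr_gt0, mulr_gt0, exprn_gt0).
(* The last witness is the Gaussian integral at [\sum_i w i ^+ 2 = 1], the worst case: its value
   decreases as this sum grows. *)
exists p, b, ((Num.sqrt a)^-1 ^+ n.+1 * Num.sqrt (a / (a + b))); split.
- set c' := _ * _.
  have c'0 : 0 <= c' by rewrite mulr_ge0 ?exprn_ge0 ?invr_ge0 ?sqrtr_ge0.
  split => //; first exact: ltW.
  rewrite -(ltr_sqr (c'0 : c' \is Num.nneg) (ltW d0 : delta \is Num.nneg)) /c'.
  rewrite exprMn -exprM mulnC exprM exprVn !sqr_sqrtr ?(ltW a0)//; last first.
    by rewrite divr_ge0 ?addr_ge0 ?ltW.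
  (* With [N = n + 1], the square of [c'] is [a ^ (- N) * delta ^+ 2 / (delta ^+ 2 + e)]; since
     [a ^ (- N) <= e], it is below [delta ^+ 2]. *)
  have -> : a / (a + b) = delta ^+ 2 / (delta ^+ 2 + expR 1).
    rewrite /b; field; rewrite !gt_eqF//.
      by rewrite addr_gt0 ?mulr_gt0 ?exprn_gt0.
    by rewrite addr_gt0 ?exprn_gt0.
  have d20 : 0 < delta ^+ 2 by rewrite exprn_gt0.
  rewrite mulrCA gtr_pMr// ltr_pdivrMr ?addr_gt0// mul1r.
  rewrite (@le_lt_trans _ _ (expR 1))// ?ltrDr//.
  by rewrite /a invf_div expR1_bound.
- rewrite /b -mulrA mulVf ?mulr1 ?gt_eqF ?exprn_gt0// pE /a; ring.
- move=> w w1.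
  have W0 : 0 < \sum_i w i ^+ 2 by exact: lt_le_trans w1.
  have p1 : p < 1 by rewrite /p gtrBl.
  have := gint_expR_quad _ w p b 0 0 p1 (ltW b0).
  under eq_gint do rewrite !add0r.
  move=> ->; rewrite lee_fin ap expr0n/= !mul0r subrr expR0 mulr1.
  apply: ler_wpM2l; first by rewrite exprn_ge0 ?invr_ge0 ?sqrtr_ge0.
  have ab0 : 0 < a + b by exact: addr_gt0.
  have abW0 : 0 < a + b * \sum_i w i ^+ 2 by rewrite addr_gt0// (mulr_gt0 b0).
  rewrite ler_sqrt; last by rewrite divr_ge0// ltW.
  rewrite ler_pM2l// lef_pV2//.
  by rewrite lerD2l ler_peMr// (ltW b0).
Qed.

(** * Measurability in R^d *)

Section BorelRd.
Context {R : realType} {d : nat}.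

Let coord_ball (k : {ffun 'I_d -> rat} * nat) : set 'rV[R]_d :=
  [set y | forall i, ball (ratr (k.1 i) : R) (k.2.+1%:R^-1) (y 0 i)].

(** Cubes with rational centres and radii [1 / (k + 1)] form a countable base. If the [e]-ball
    around [x] lies in [U], take a radius below [e / 2] and a rational centre within that radius of
    [x] in each coordinate. *)
Let open_coord_ball_cover (U : set 'rV[R]_d) : open U ->
  U = \bigcup_(k in [set k | coord_ball k `<=` U]) coord_ball k.
Proof.
move=> oU; apply/seteqP; split => [x Ux|x [k /= kU xk]]; last exact: kU.
have /nbhs_ballP[e /= e0 eU] : nbhs x U by exact: open_nbhs_nbhs.
have [n] : exists n : nat, 0 + n.+1%:R^-1 < e / 2 by apply: ltr_add_invr; rewrite divr_gt0.
rewrite add0r => ne.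
have n0 : 0 < n.+1%:R^-1 :> R by rewrite invr_gt0.
have /choice[q qx] : forall i : 'I_d, exists q : rat, `|ratr q - x 0 i| < n.+1%:R^-1 :> R.
  move=> i; have [|q] := @rat_in_itvoo R (x 0 i - n.+1%:R^-1) (x 0 i + n.+1%:R^-1).
    by rewrite ltrD2l gtrN.
  by rewrite in_itv/= -ltr_distl => ?; exists q.
exists ([ffun i => q i], n) => /= [y yq|i]; last by rewrite ffunE; exact: qx.
apply: eU; split=> // i j; rewrite ord1.
have := yq j; rewrite ffunE => /= yqj.
rewrite /ball /= -(subrK (ratr (q j)) (x 0 j)) -addrA.
apply: (le_lt_trans (ler_normD _ _)); rewrite [e]splitr.
by apply: ltrD; [rewrite distrC|]; apply: lt_trans ne; [exact: qx|exact: yqj].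
Qed.

(** Open sets are countable unions of rational cubes, and the preimage of a cube is a finite
    intersection of coordinate preimages. *)
Lemma measurable_fun_Rd d' (T : measurableType d') (f : T -> Rd R d) :
  (forall i, measurable_fun [set: T] (fun t => (f t : 'rV[R]_d) 0 i)) ->
  measurable_fun [set: T] f.
Proof.
move=> mf; apply: (@measurability _ _ T (Rd R d) setT f (@open 'rV[R]_d)) => //.
move=> _ [U oU <-]; rewrite setTI (open_coord_ball_cover U oU).
rewrite preimage_bigcup bigcup_mkcond; apply: countable_bigcupT_measurable => // k.
case: ifP => _ //.
rewrite (_ : _ @^-1` _ = \bigcap_i ((fun t => (f t : 'rV[R]_d) 0 i) @^-1`
    ball (ratr (k.1 i) : R) (k.2.+1%:R^-1))); last first.
  by apply/seteqP; split => t /=; [move=> H i _; exact: H|move=> H i; exact: H].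
apply: fin_bigcap_measurable => // i _; rewrite -[X in measurable X]setTI.
by apply: mf => //; exact: measurable_ball.
Qed.

Lemma measurable_coord (i : 'I_d) :
  measurable_fun [set: Rd R d] (fun x : Rd R d => (x : 'rV[R]_d) 0 i).
Proof.
apply: (measurability _ (RGenOpens.measurableE R)).
move=> _ [_ [a [b ->] <-]]; rewrite setTI; apply: sub_sigma_algebra.
apply: (open_comp (f := fun x : 'rV[R]_d => x 0 i)); last exact: interval_open.
by move=> x _; exact: coord_continuous.
Qed.

Lemma measurable_RdD d' (T : measurableType d') (u v : T -> Rd R d) :
  measurable_fun [set: T] u -> measurable_fun [set: T] v ->
  measurable_fun [set: T] (fun t => (u t : 'rV[R]_d) + v t : Rd R d).
Proof.
move=> mu mv; apply: measurable_fun_Rd => i.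
rewrite (_ : (fun _ => _) = (fun t => (u t : 'rV[R]_d) 0 i + (v t : 'rV[R]_d) 0 i)).
  by apply: measurable_funD; exact: (measurableT_comp (measurable_coord i)).
by apply/funext => t; rewrite mxE.
Qed.

Lemma measurable_RdB d' (T : measurableType d') (u v : T -> Rd R d) :
  measurable_fun [set: T] u -> measurable_fun [set: T] v ->
  measurable_fun [set: T] (fun t => (u t : 'rV[R]_d) - v t : Rd R d).
Proof.
move=> mu mv; apply: measurable_fun_Rd => i.
rewrite (_ : (fun _ => _) = (fun t => (u t : 'rV[R]_d) 0 i - (v t : 'rV[R]_d) 0 i)).
  by apply: measurable_funB; exact: (measurableT_comp (measurable_coord i)).
by apply/funext => t; rewrite !mxE.
Qed.

End BorelRd.

(** * The random perturbation *)

Section SphericalVector.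
Context {R : realType} {n d : nat}.

Definition row_of_tuple (g : n.-tuple R) : 'rV[R]_n := \row_i tnth g i.

(* For [g = 0] this is [0], as [0^-1 = 0]. *)
Definition sphere_vec (B : 'M[R]_(n, d)) (rho : R) (g : n.-tuple R) : 'rV[R]_d :=
  (rho / norm2 (row_of_tuple g)) *: (row_of_tuple g *m B).

Lemma norm2_sphere_vec (B : 'M[R]_(n, d)) (rho : R) (g : n.-tuple R) :
  B *m B^T = 1%:M -> 0 <= rho -> norm2 (sphere_vec B rho g) <= rho.
Proof.
move=> BB rho0; rewrite norm2Z norm2_mul_orthonormal//.
rewrite ger0_norm ?divr_ge0 ?norm2_ge0//.
have [->|g0] := eqVneq (norm2 (row_of_tuple g)) 0; first by rewrite mulr0.
by rewrite divfK.
Qed.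

Lemma measurable_sphere_vec (B : 'M[R]_(n, d)) (rho : R) :
  measurable_fun [set: n.-tuple R] (sphere_vec B rho : n.-tuple R -> Rd R d).
Proof.
apply: measurable_fun_Rd => i.
have msum : measurable_fun [set: n.-tuple R] (fun g => \sum_j tnth g j * B j i).
  apply: measurable_sum => j; apply: measurable_funM => //.
  exact: measurable_tnth.
have mnorm : measurable_fun [set: n.-tuple R] (fun g => dotv (row_of_tuple g) (row_of_tuple g)).
  apply: measurable_sum => j.
  by apply: measurable_funM;
    (rewrite (_ : (fun _ => _) = (fun g => tnth g j));
      [exact: measurable_tnth|apply/funext => g; rewrite mxE]).
(* Root and inverse become real powers, which are measurable; at 0 both the inverse and the power
   [-1] are 0. *)
rewrite (_ : (fun _ => _) = (fun g => rho *
    (dotv (row_of_tuple g) (row_of_tuple g) `^ (2^-1)) `^ (-1) *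
    \sum_j tnth g j * B j i)); last first.
  apply/funext => g; rewrite powR12_sqrt ?dotvv_ge0// powR_inv1 ?sqrtr_ge0//.
  by rewrite !mxE; congr (_ * _); apply: eq_bigr => j _; rewrite mxE.
apply: measurable_funM => //; apply: measurable_funM => //.
apply: (measurableT_comp (measurable_powR _)).
exact: (measurableT_comp (measurable_powR _)).
Qed.

End SphericalVector.

(** Labels are finitely many, so the event splits according to the common label. *)
Lemma measurable_label_eq d' (T : measurableType d') (R : realType) (d L : nat)
    (khat : 'rV[R]_d -> 'I_L) (u v : T -> Rd R d) :
  (forall k : 'I_L, measurable [set x : Rd R d | khat x = k]) ->
  measurable_fun [set: T] u -> measurable_fun [set: T] v ->
  measurable [set t | khat (u t) = khat (v t)].
Proof.
move=> mk mu mv.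
rewrite (_ : [set t | _] = \bigcup_(k in [set: 'I_L])
    (u @^-1` [set x : Rd R d | khat x = k] `&` v @^-1` [set x : Rd R d | khat x = k])).
  apply: fin_bigcup_measurable => // k _; apply: measurableI.
    by rewrite -[X in measurable X]setTI; apply: mu.
  by rewrite -[X in measurable X]setTI; apply: mv.
apply/seteqP; split => [t /= e|t [k _ [/= -> ->]]//].
by exists (khat (v t)).
Qed.

(** With [z] the product of [y] and the unnormalised vector, the hypothesis reads [rho * |z| < N]
    for [N > 0]; square it and multiply by [p / 2]. The factors [s] and [s^-1] cancel. *)
Lemma sphere_vec_exponent_le (R : realType) (n d : nat) (B : 'M[R]_(n, d)) (y : 'rV[R]_d)
    (rho s p b : R) (g : n.-tuple R) :
  0 < s -> 0 <= p -> b = p * (rho * s) ^+ 2 ->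
  `|dotv y (sphere_vec B rho g)| < 1 ->
  b / 2 * (\sum_i (s^-1 * (y *m B^T) 0 i) * tnth g i) ^+ 2
    <= p / 2 * \sum_i tnth g i ^+ 2.
Proof.
move=> s0 p0 -> yv.
set N := norm2 (row_of_tuple g); set D := \sum_i tnth g i ^+ 2.
have ND : N ^+ 2 = D.
  by rewrite sqr_norm2; apply: eq_bigr => i _; rewrite !mxE expr2.
have -> : \sum_i s^-1 * (y *m B^T) 0 i * tnth g i = s^-1 * dotv y (row_of_tuple g *m B).
  have -> : dotv y (row_of_tuple g *m B) = dotv (y *m B^T) (row_of_tuple g).
    have := dotvE y (row_of_tuple g *m B); rewrite trmx_mul mulmxA dotvE.
    by move=> /matrixP/(_ 0 0); rewrite !mxE eqxx.
  by rewrite mulr_sumr; apply: eq_bigr => i _; rewrite !mxE mulrA.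
set z := dotv y _.
have zN : (rho * z) ^+ 2 <= D.
  (* At [N = 0] the sphere vector is 0 and the hypothesis carries no information, but both sides
     vanish. *)
  rewrite -ND; have [N0|N0] := eqVneq N 0.
    have -> : z = 0.
      move/eqP: N0; rewrite norm2_eq0 => /eqP N0.
      by rewrite /z N0 mul0mx /dotv big1// => i _; rewrite mxE mulr0.
    by rewrite mulr0 expr0n sqr_ge0.
  have Npos : 0 < N by rewrite lt_neqAle eq_sym N0 norm2_ge0.
  rewrite -ler_sqrt ?sqr_ge0// !sqrtr_sqr (ger0_norm (ltW Npos)).
  move: yv; rewrite dotvZr -/z -/N mulrAC normrM normfV (ger0_norm (ltW Npos)).
  by rewrite ltr_pdivrMr// mul1r => /ltW.
have -> : p * (rho * s) ^+ 2 / 2 * (s^-1 * z) ^+ 2 = p / 2 * (rho * z) ^+ 2.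
  by field; rewrite gt_eqF.
by apply: ler_wpM2l => //; rewrite divr_ge0.
Qed.

(** * Existence of the universal perturbation *)

Theorem theorem1 (R : realType) (d L m : nat)
  (f : 'rV[R]_d -> 'rV[R]_L) (khat : 'rV[R]_d -> 'I_L)
  (hkhat : is_argmax f khat)
  (hkmeas : forall k : 'I_L, measurable [set x : Rd R d | khat x = k])
  (mu : probability (Rd R d) R)
  (r : 'rV[R]_d -> 'rV[R]_d)
  (hrmin : {ae mu, forall x : Rd R d, is_min_pert khat x (r x)})
  (hr1 : {ae mu, forall x : Rd R d, norm2 (r x) = 1})
  (xi delta : R) (hxi0 : 0 <= xi) (hxi1 : xi < 1) (hdelta : 0 < delta)
  (S : 'M[R]_d) (hS : \rank S = m)
  (hproj : {ae mu, forall x : Rd R d, 1 - xi <= norm2 (orth_proj S (r x))})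
  (hLs : {ae mu, forall x : Rd R d,
            Ls khat r x (Num.sqrt (expR 1 * m%:R) / (delta * (1 - xi)))}) :
  exists v : 'rV[R]_d,
    norm2 v <= Num.sqrt (expR 1 * m%:R) / (delta * (1 - xi)) /\
    ((1 - delta)%:E <=
       mu [set x : Rd R d | khat ((x : 'rV[R]_d) + v)%R <> khat x \/
                          khat ((x : 'rV[R]_d) - v)%R <> khat x])%E.
Proof.
set rho := Num.sqrt _ / _ in hLs *.
have s0 : 0 < 1 - xi by rewrite subr_gt0.
have rho0 : 0 <= rho by rewrite divr_ge0 ?sqrtr_ge0// mulr_ge0// ltW.
have [B [BB BS]] := orthonormal_basis _ S hS.
(* For [m = 0] every projection has norm 0, less than [1 - xi], so [hproj] would make the whole
   space negligible. *)
have m0 : (0 < m)%N.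
  rewrite lt0n; apply/eqP => m0; suff : mu setT = 0%E.
    by rewrite probability_setT => /eqP; rewrite onee_eq0.
  apply/negligibleP => //; apply: negligibleS hproj => x _ /=; apply/negP.
  rewrite (norm2_orth_proj _ _ _ _ BB BS) -ltNge.
  rewrite /norm2 /dotv big1 ?sqrtr0// => i.
  by have := ltn_ord i; rewrite {2}m0.
have [p [b [c' [[p0 b0 c'0 c'd] bE chernoff]]]] := gaussian_chernoff R m delta m0 hdelta.
(* The radius [rho] is chosen so that [rho * (1 - xi)] squared is [e * m / delta ^+ 2], the ratio of
   [b] to [p]. *)
have bE' : b = p * (rho * (1 - xi)) ^+ 2.
  have -> : rho * (1 - xi) = Num.sqrt (expR 1 * m%:R) / delta.
    by rewrite /rho; field; rewrite !gt_eqF.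
  rewrite exprMn sqr_sqrtr ?mulr_ge0 ?expR_ge0// exprVn mulrA -bE mulfK//.
  by rewrite expf_neq0// gt_eqF.
pose bad := [set z : Rd R d * m.-tuple R |
  khat ((z.1 : 'rV[R]_d) + sphere_vec B rho z.2) = khat z.1 /\
  khat ((z.1 : 'rV[R]_d) - sphere_vec B rho z.2) = khat z.1].
have mbad : measurable bad.
  have mv := measurableT_comp (measurable_sphere_vec B rho)
    (@measurable_snd _ _ (Rd R d) (m.-tuple R)).
  have mx := @measurable_fst _ _ (Rd R d) (m.-tuple R).
  by apply: measurableI; apply: (measurable_label_eq _ _ _ _ _ khat) => //;
    [exact: measurable_RdD mx mv|exact: measurable_RdB mx mv].
pose F (z : Rd R d * m.-tuple R) : \bar R := (\1_bad z)%:E.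
have mF : measurable_fun setT F by apply/measurable_EFinP; exact: measurable_indic.
have F0 z : (0 <= F z)%E by rewrite lee_fin.
have key : {ae mu, forall x : Rd R d, setT x -> (gint m (fun g => F (x, g)) <= c'%:E)%E}.
  apply: filterS3 hr1 hproj hLs => x rx1 rxS Lx _.
  (* Dividing by [1 - xi] turns the projection bound into the normalisation required by
     [chernoff]. *)
  pose w i := (1 - xi)^-1 * (r x *m B^T) 0 i.
  have w1 : 1 <= \sum_i w i ^+ 2.
    rewrite (_ : \sum_i _ = (1 - xi)^-1 ^+ 2 * norm2 (r x *m B^T) ^+ 2); last first.
      by rewrite sqr_norm2 mulr_sumr; apply: eq_bigr => i _; rewrite /w exprMn.
    rewrite -exprMn exprn_ege1// mulrC ler_pdivlMr// mul1r.
    by rewrite -(norm2_orth_proj _ _ _ (r x) BB BS).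
  apply: le_trans (chernoff _ w1); apply: le_gint => [|||g].
  - exact: (measurable_fun_pair2 x mF).
  - apply/measurable_EFinP; apply: measurableT_comp => //; apply: measurable_funB.
      apply: measurable_funM => //; apply: measurable_sum => i.
      by apply: measurable_funX; exact: measurable_tnth.
    apply: measurable_funM => //; apply: measurable_funX; apply: measurable_sum => i.
    by apply: measurable_funM => //; exact: measurable_tnth.
  - by [].
  - rewrite lee_fin indicE; have [/set_mem[/= bad1 bad2]|_] := boolP (_ \in bad);
      last exact: expR_ge0.
    rewrite -[X in X <= _]expR0 ler_expR subr_ge0.
    apply: (sphere_vec_exponent_le _ _ _ B (r x) rho (1 - xi)) => //; first exact: ltW.
    (* A pair in [bad] keeps both labels, so [Ls] excludes a product of absolute value at least
       1. *)
    rewrite ltNge; apply/negP => rv.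
    have := Lx (sphere_vec B rho g) (norm2_sphere_vec _ _ _ BB rho0).
    by rewrite rx1 expr1n => /(_ rv) [].
have Fint : (gint m (fun g => \int[mu]_x F (x, g)) <= c'%:E)%E.
  rewrite -gint_tonelli//.
  have -> : c'%:E = (\int[mu]_(x in setT) (cst c'%:E) x)%E.
    by rewrite integral_cst// [X in (_ * X)%E](_ : _ = 1%E) ?mule1//; exact: probability_setT.
  apply: ae_ge0_le_integral => //.
  - by move=> x _; exact: gint_ge0.
  - exact: measurable_gint.
have [||g Fg] := gint_exists_le _ _ _ _ _ _ (ltW hdelta) c'd Fint.
- exact: (measurable_fun_fubini_tonelli_G (m1 := mu) F).
- by move=> g; exact: integral_ge0.
exists (sphere_vec B rho g); split; first exact: norm2_sphere_vec.
set A := [set x | _].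
have mbg : measurable (ysection bad g) by exact: measurable_ysection.
have -> : A = ~` ysection bad g.
  apply/seteqP; split => x /= => [ne /set_mem[/= b1 b2]|nb]; first by case: ne.
  by apply/not_andP => b12; apply: nb; exact: mem_set.
(* The bad section has measure equal to the integral of its indicator, bounded by [delta] through
   [Fg]. *)
rewrite probability_setC// EFinB; apply: leeB => //.
apply: le_trans Fg; rewrite -[ysection _ _]setIT -integral_indic//.
apply: ge0_le_integral => //.
  by apply/measurable_EFinP; exact: measurable_indic.
  exact: (measurable_fun_pair1 g mF).
by move=> x _; rewrite /F !indicE mem_ysection.
Qed.
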